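(* Let $M\ge 1$, $D=2^M$, let $\rho$ be a density matrix on $\mathbb{C}^D$, and let $\ell\ge 1$ be an integer. Consider the binary-tree SWAP-test circuit with $2^\ell$ leaves, each leaf being an identical copy of $\rho$. For each string $\vec\sigma_\ell\in\{+1,-1\}^{2^\ell-1}$ of SWAP-test outcomes let $P_{\vec\sigma_\ell}$ be its probability, $\rho_{\vec\sigma_\ell}$ the associated conditional output state, and $\Omega_{\vec\sigma_\ell}=\prod_{i=1}^{2^\ell-1}\sigma_i$ the total parity. Then the ordinary branch average satisfies $$\sum_{\vec\sigma_\ell} P_{\vec\sigma_\ell}\,\rho_{\vec\sigma_\ell}=\rho,$$ while the total-parity-weighted branch average satisfies $$\sum_{\vec\sigma_\ell} P_{\vec\sigma_\ell}\,\Omega_{\vec\sigma_\ell}\,\rho_{\vec\sigma_\ell}=\rho^{2^\ell}.$$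
   Context: SWAP gadget. For density matrices $X,Y$ on $\mathbb{C}^D$, let $\mathrm{SWAP}$ be the operator exchanging the two tensor factors $A,B$ of $\mathbb{C}^D\otimes\mathbb{C}^D$ and $\Pi_\pm=\frac12(I\pm\mathrm{SWAP})$. The SWAP gadget measures $\{\Pi_+,\Pi_-\}$ on $X\otimes Y$ and discards the second register $B$. Outcome $\sigma\in\{+1,-1\}$ ($+1$ for $\Pi_+$, $-1$ for $\Pi_-$) has probability $$P_{\sigma|X,Y}=\tfrac12\left(1+\sigma\,\mathrm{Tr}[XY]\right)$$ and, when this is positive, yields the state $$\rho_\sigma(X,Y)=\frac{\mathrm{Tr}_B[\Pi_\sigma(X\otimes Y)\Pi_\sigma]}{P_{\sigma|X,Y}}=\frac{X+Y+\sigma(XY+YX)}{4P_{\sigma|X,Y}}.$$ Binary tree. The probabilities and conditional states are defined recursively on the number of rounds $\ell$. For $\ell=1$ and $\sigma_1\in\{\pm1\}$: $P_{\sigma_1}=\frac12(1+\sigma_1\mathrm{Tr}(\rho^2))$ and $\rho_{\sigma_1}=\rho_{\sigma_1}(\rho,\rho)$. An outcome string for $\ell+1$ rounds is a triple $(\vec\alpha,\vec\beta,\sigma)$, where $\vec\alpha,\vec\beta$ are outcome strings of two independent $\ell$-round subtrees and $\sigma\in\{\pm1\}$ is the outcome of the SWAP gadget merging their outputs (so $\ell$ rounds involve $2^\ell-1$ outcomes), and $$P_{(\vec\alpha,\vec\beta,\sigma)}=P_{\vec\alpha}P_{\vec\beta}\,\tfrac12\left(1+\sigma\,\mathrm{Tr}[\rho_{\vec\alpha}\rho_{\vec\beta}]\right),\qquad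 \rho_{(\vec\alpha,\vec\beta,\sigma)}=\rho_\sigma(\rho_{\vec\alpha},\rho_{\vec\beta}).$$ Convention: branches of probability zero, whose conditional state is undefined, contribute $0$ to all sums over branches (equivalently, sums run over branches of positive probability). *)

(* Defs.v *)
(* Everything is stated over a field C : numClosedFieldType, of which R[i] with
   R : realType (the complex numbers) is an instance. *)
From HB Require Import structures.
From mathcomp Require Import all_boot all_order all_algebra.
From mathcomp Require Import sesquilinear spectral.
From mathcomp Require Import mxtens complex reals zify.

Set Implicit Arguments.
Unset Strict Implicit.
Unset Printing Implicit Defensive.

Import Order.TTheory GRing.Theory Num.Theory.
Local Open Scope ring_scope.
Local Open Scope sesquilinear_scope.

Definition densitymx (C : numClosedFieldType) (D : nat) (X : 'M[C]_D) : Prop :=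
  [/\ X \is hermsymmx,
      forall v : 'cV[C]_D, 0 <= (v^t* *m X *m v) 0 0
    & \tr X = 1].

(* A measurement outcome sigma in {+1, -1} is encoded by b : bool with
   sigma = (-1) ^+ b, so [false] is the outcome +1 and [true] is -1. *)
Definition outcome_sign (C : numClosedFieldType) (b : bool) : C := (-1) ^+ b.

(* The tensor product C^D (x) C^D is indexed by 'I_(D * D) through
   mxtens_index, register A being the first component. *)
Definition swapmx (C : numClosedFieldType) (D : nat) : 'M[C]_(D * D) :=
  \matrix_(i, j) (((mxtens_unindex i).1 == (mxtens_unindex j).2) &&
                  ((mxtens_unindex i).2 == (mxtens_unindex j).1))%:R.

Definition swap_proj (C : numClosedFieldType) (D : nat) (b : bool) :
    'M[C]_(D * D) :=
  2^-1 *: (1%:M + outcome_sign C b *: swapmx C D).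

Definition ptraceB (C : numClosedFieldType) (D : nat) (Z : 'M[C]_(D * D)) :
    'M[C]_D :=
  \matrix_(i, j) \sum_k Z (mxtens_index (i, k)) (mxtens_index (j, k)).

Definition swap_prob (C : numClosedFieldType) (D : nat) (b : bool)
    (X Y : 'M[C]_D) : C :=
  2^-1 * (1 + outcome_sign C b * \tr (X *m Y)).

(* At swap_prob b X Y = 0 the value is the junk 0; sums over outcome strings run
   over branches of positive probability only. *)
Definition swap_state (C : numClosedFieldType) (D : nat) (b : bool)
    (X Y : 'M[C]_D) : 'M[C]_D :=
  (swap_prob b X Y)^-1 *:
    ptraceB (swap_proj C D b *m (X *t Y) *m swap_proj C D b).

(* Outcome strings of the tree with l rounds.  The recursion is started at the
   bare leaf l = 0 (no measurement); [branch_prob1] and [branch_state1] below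
   give the values for one round. *)
Fixpoint outcomes (l : nat) : finType :=
  if l is l'.+1 then (outcomes l' * outcomes l' * bool)%type else unit.

Fixpoint branch_state (C : numClosedFieldType) (D : nat) (rho : 'M[C]_D)
    (l : nat) : outcomes l -> 'M[C]_D :=
  match l return outcomes l -> 'M[C]_D with
  | 0 => fun=> rho
  | l'.+1 => fun s =>
      let: (a, b, o) := s in
      swap_state o (branch_state rho a) (branch_state rho b)
  end.

Fixpoint branch_prob (C : numClosedFieldType) (D : nat) (rho : 'M[C]_D)
    (l : nat) : outcomes l -> C :=
  match l return outcomes l -> C with
  | 0 => fun=> 1
  | l'.+1 => fun s =>
      let: (a, b, o) := s in
      branch_prob rho a * branch_prob rho b *
        swap_prob o (branch_state rho a) (branch_state rho b)
  end.

Fixpoint outcome_seq (l : nat) : outcomes l -> seq bool :=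
  match l return outcomes l -> seq bool with
  | 0 => fun=> [::]
  | l'.+1 => fun s =>
      let: (a, b, o) := s in outcome_seq a ++ outcome_seq b ++ [:: o]
  end.

Definition parity (C : numClosedFieldType) (l : nat) (s : outcomes l) : C :=
  \prod_(b <- outcome_seq s) outcome_sign C b.

Lemma size_outcome_seq (l : nat) (s : outcomes l) :
  size (outcome_seq s) = (2 ^ l - 1)%N.
Proof.
elim: l s => [|l IHl] //= [[a b] o].
rewrite !size_cat !IHl /= expnS.
by have := expn_gt0 2 l; lia.
Qed.

Lemma outcome_seq_inj (l : nat) : injective (@outcome_seq l).
Proof.
elim: l => [|l IHl]; first by do 2!case.
move=> [[a b] o] [[a' b'] o'] /= /eqP.
rewrite eqseq_cat ?size_outcome_seq // => /andP[/eqP/IHl -> ].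
by rewrite eqseq_cat ?size_outcome_seq // => /andP[/eqP/IHl -> /eqP[->]].
Qed.

Lemma card_outcomes (l : nat) : #|outcomes l| = (2 ^ (2 ^ l - 1))%N.
Proof.
elim: l => [|l IHl]; first by rewrite card_unit.
rewrite /= !card_prod card_bool IHl -!expnD -expnSr; congr expn.
rewrite (expnS 2).
by have := expn_gt0 2 l; lia.
Qed.

Lemma swapmx_tensr (C : numClosedFieldType) (D n p : nat)
    (X : 'M[C]_(D, n)) (Y : 'M[C]_(D, p)) i j k l :
  (swapmx C D *m (X *t Y)) (mxtens_index (i, j)) (mxtens_index (k, l)) =
  X j k * Y i l.
Proof.
rewrite mxE (bigD1 (mxtens_index (j, i))) //= mxE !mxtens_indexK /= !eqxx.
rewrite mul1r tensmxE big1 ?addr0 // => h.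
case: (mxtens_indexP h) => u v; rewrite mxE !mxtens_indexK /=.
rewrite (can_eq (@mxtens_indexK _ _)) xpair_eqE andbC ![_ == u]eq_sym.
by rewrite ![_ == v]eq_sym => /negbTE ->; rewrite mul0r.
Qed.

Lemma swapmx_tensl (C : numClosedFieldType) (D n p : nat)
    (X : 'M[C]_(n, D)) (Y : 'M[C]_(p, D)) i j k l :
  ((X *t Y) *m swapmx C D) (mxtens_index (i, j)) (mxtens_index (k, l)) =
  X i l * Y j k.
Proof.
rewrite mxE (bigD1 (mxtens_index (l, k))) //= [swapmx _ _ _ _]mxE.
rewrite !mxtens_indexK /= !eqxx mulr1 tensmxE big1 ?addr0 // => h.
case: (mxtens_indexP h) => u v; rewrite [swapmx _ _ _ _]mxE !mxtens_indexK /=.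
rewrite (can_eq (@mxtens_indexK _ _)) xpair_eqE.
by move=> /negbTE ->; rewrite mulr0.
Qed.

Lemma swapmxC (C : numClosedFieldType) (D : nat) (X Y : 'M[C]_D) :
  swapmx C D *m (X *t Y) = (Y *t X) *m swapmx C D.
Proof.
apply/matrixP => i j; case: (mxtens_indexP i) => i1 i2.
case: (mxtens_indexP j) => j1 j2.
by rewrite swapmx_tensr swapmx_tensl mulrC.
Qed.

Lemma swapmxK (C : numClosedFieldType) (D : nat) :
  swapmx C D *m swapmx C D = 1%:M.
Proof.
have E : 1%:M *t 1%:M = 1%:M :> 'M[C]_(D * D).
  apply/matrixP => i j; case: (mxtens_indexP i) => i1 i2.
  case: (mxtens_indexP j) => j1 j2; rewrite tensmxE !mxE.
  by rewrite (can_eq (@mxtens_indexK _ _)) xpair_eqE -natrM mulnb.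
apply/matrixP => i j; case: (mxtens_indexP i) => i1 i2.
case: (mxtens_indexP j) => j1 j2.
rewrite -[X in X *m _]mulmx1 -E -mulmxA mxE.
rewrite (bigD1 (mxtens_index (i2, i1))) //= mxE !mxtens_indexK /= !eqxx mul1r.
rewrite swapmx_tensl big1 ?addr0 ?tensmxE 1?mulrC // => h.
case: (mxtens_indexP h) => u v; rewrite mxE !mxtens_indexK /=.
rewrite (can_eq (@mxtens_indexK _ _)) xpair_eqE andbC ![_ == u]eq_sym.
by rewrite ![_ == v]eq_sym => /negbTE ->; rewrite mul0r.
Qed.

Lemma swap_proj_idem (C : numClosedFieldType) (D : nat) (b : bool) :
  swap_proj C D b *m swap_proj C D b = swap_proj C D b.
Proof.
have s2 : outcome_sign C b * outcome_sign C b = 1.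
  by rewrite /outcome_sign -signr_addb addbb.
rewrite /swap_proj -scalemxAl -scalemxAr mulmxDl !mulmxDr !mul1mx mulmx1.
rewrite -scalemxAl -scalemxAr swapmxK !scalerA s2 scale1r.
set S := _ *: swapmx C D; rewrite [S + _]addrC -mulr2n -[in LHS]scaler_nat.
by rewrite scalerA mulfVK ?pnatr_eq0.
Qed.

Lemma swap_proj_tens (C : numClosedFieldType) (D : nat) (b : bool)
    (X Y : 'M[C]_D) i j k l :
  (swap_proj C D b *m (X *t Y) *m swap_proj C D b)
    (mxtens_index (i, j)) (mxtens_index (k, l)) =
  4^-1 * (X i k * Y j l + Y i k * X j l +
          outcome_sign C b * (X i l * Y j k + Y i l * X j k)).
Proof.
have s2 : outcome_sign C b * outcome_sign C b = 1.
  by rewrite /outcome_sign -signr_addb addbb.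
have -> : swap_proj C D b *m (X *t Y) *m swap_proj C D b =
  4^-1 *: (X *t Y + Y *t X +
    outcome_sign C b *: (X *t Y *m swapmx C D + Y *t X *m swapmx C D)).
  rewrite /swap_proj -!scalemxAl -scalemxAr scalerA -invfM -natrM.
  congr (_ *: _); rewrite mulmxDl mul1mx mulmxDr mulmx1 mulmxDl.
  rewrite -!scalemxAl -!scalemxAr scalerA s2 scale1r swapmxC.
  rewrite -mulmxA swapmxK mulmx1 scalerDr.
  by rewrite [X in _ + X = _]addrC addrACA; congr (_ + _); rewrite addrC.
have mxD (A B : 'M[C]_(D * D)) u v : (A + B) u v = A u v + B u v.
  by rewrite mxE.
have mxZ a (A : 'M[C]_(D * D)) u v : (a *: A) u v = a * A u v by rewrite mxE.
by rewrite !(mxZ, mxD) !tensmxE !swapmx_tensl.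
Qed.

Lemma ptraceB_swap (C : numClosedFieldType) (D : nat) (b : bool)
    (X Y : 'M[C]_D) :
  ptraceB (swap_proj C D b *m (X *t Y) *m swap_proj C D b) =
  4^-1 *: (\tr Y *: X + \tr X *: Y +
           outcome_sign C b *: (X *m Y + Y *m X)).
Proof.
apply/matrixP => i j; rewrite mxE; under eq_bigr do rewrite swap_proj_tens.
rewrite -mulr_sumr !big_split /= -!mulr_sumr big_split /= !mxE.
congr (_ * (_ + _ + _ * (_ + _))).
by rewrite mulrC. by rewrite mulrC.
Qed.

Lemma swap_prob_born (C : numClosedFieldType) (D : nat) (b : bool)
    (X Y : 'M[C]_D) : \tr X = 1 -> \tr Y = 1 ->
  \tr (swap_proj C D b *m (X *t Y) *m swap_proj C D b) = swap_prob b X Y.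
Proof.
move=> trX trY.
have -> (Z : 'M[C]_(D * D)) : \tr Z = \tr (ptraceB Z).
  rewrite /mxtrace; under [RHS]eq_bigr do rewrite mxE.
  rewrite pair_bigA /= (reindex (@mxtens_index D D)).
    by apply: eq_bigr => -[].
  by exists (@mxtens_unindex D D) => i _; rewrite (mxtens_indexK, mxtens_unindexK).
rewrite ptraceB_swap trX trY !scale1r mxtraceZ !mxtraceD mxtraceZ mxtraceD.
rewrite trX trY [\tr (Y *m X)]mxtrace_mulC -!mulr2n mulrnAr -mulrnDl.
by rewrite -[_ *+ 2]mulr_natl mulrA (natrM _ 2 2) invfM mulfVK ?pnatr_eq0.
Qed.

Lemma swap_stateE (C : numClosedFieldType) (D : nat) (b : bool)
    (X Y : 'M[C]_D) : \tr X = 1 -> \tr Y = 1 ->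
  swap_state b X Y =
  (4 * swap_prob b X Y)^-1 *: (X + Y + outcome_sign C b *: (X *m Y + Y *m X)).
Proof.
move=> trX trY; rewrite /swap_state ptraceB_swap trX trY !scale1r scalerA.
by rewrite -invfM [_ * 4]mulrC.
Qed.

Lemma branch_prob1 (C : numClosedFieldType) (D : nat) (rho : 'M[C]_D)
    (b : bool) :
  branch_prob rho ((tt, tt, b) : outcomes 1) =
  2^-1 * (1 + outcome_sign C b * \tr (rho ^+ 2)).
Proof. by rewrite /= !mul1r. Qed.

Lemma branch_state1 (C : numClosedFieldType) (D : nat) (rho : 'M[C]_D)
    (b : bool) :
  branch_state rho ((tt, tt, b) : outcomes 1) = swap_state b rho rho.
Proof. by []. Qed.

(* Main.v *)
(* On branches of positive probability the conditional states are density
   matrices, and the unnormalised branch operators A_s = P_s rho_s satisfy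
     A_(a,b,o) = (P_b A_a + P_a A_b + sigma (A_a A_b + A_b A_a)) / 4,
   an identity which also holds at null branches, because a positive semidefinite
   operator of trace zero vanishes.  Summing over sigma kills the anticommutator,
   and weighting by sigma keeps only the anticommutator: so the plain average is
   preserved from one round to the next, while the parity-weighted one is squared.

   Positive semidefiniteness is used in Gram form X = B^* B, which is visibly
   stable under tensor products, congruences and partial traces; the spectral
   theorem is only needed for rho itself. *)
Require Import Defs.
From HB Require Import structures.
From mathcomp Require Import all_boot all_order all_algebra.
From mathcomp Require Import complex reals.
From mathcomp Require Import sesquilinear spectral mxtens.

Set Implicit Arguments.
Unset Strict Implicit.
Unset Printing Implicit Defensive.

Import Order.TTheory GRing.Theory Num.Theory.
Local Open Scope ring_scope.
Local Open Scope sesquilinear_scope.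

(** * Gram matrices: closure properties and vanishing trace *)

Definition is_gram (C : numClosedFieldType) (n : nat) (X : 'M[C]_n) : Prop :=
  exists m (B : 'M[C]_(m, n)), X = B^t* *m B.

Lemma adjmxK (C : numClosedFieldType) (m n : nat) (B : 'M[C]_(m, n)) :
  (B^t*)^t* = B.
Proof. by apply/matrixP => i j; rewrite !mxE conjCK. Qed.

Lemma adjmx_mul (C : numClosedFieldType) (m n p : nat) (A : 'M[C]_(m, n))
    (B : 'M[C]_(n, p)) : (A *m B)^t* = B^t* *m A^t*.
Proof. by rewrite trmx_mul map_mxM. Qed.

Lemma gram_tr (C : numClosedFieldType) (m n : nat) (B : 'M[C]_(m, n)) :
  \tr (B^t* *m B) = \sum_i \sum_j `|B j i| ^+ 2.
Proof.
apply: eq_bigr => i _; rewrite mxE; apply: eq_bigr => j _.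
by rewrite !mxE mulrC normCK.
Qed.

Lemma is_gram_tr_ge0 (C : numClosedFieldType) (n : nat) (X : 'M[C]_n) :
  is_gram X -> 0 <= \tr X.
Proof.
move=> [m [B ->]]; rewrite gram_tr; apply: sumr_ge0 => i _.
by apply: sumr_ge0 => j _; rewrite exprn_ge0.
Qed.

(** The trace of B^* B is the sum of the squared moduli of the entries of B, so each entry of B
    vanishes. *)
Lemma is_gram_tr0 (C : numClosedFieldType) (n : nat) (X : 'M[C]_n) :
  is_gram X -> \tr X = 0 -> X = 0.
Proof.
move=> [m [B ->]] /eqP; rewrite gram_tr psumr_eq0; last first.
  by move=> i _; apply: sumr_ge0 => j _; rewrite exprn_ge0.
move=> /allP B0; suff -> : B = 0 by rewrite mulmx0.
apply/matrixP => j i; have := B0 i (mem_index_enum i).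
rewrite psumr_eq0 => [/allP/(_ j (mem_index_enum j))|k _]; last first.
  by rewrite exprn_ge0.
by rewrite expf_eq0 normr_eq0 mxE => /eqP.
Qed.

Lemma is_gramZ (C : numClosedFieldType) (n : nat) (c : C) (X : 'M[C]_n) :
  0 <= c -> is_gram X -> is_gram (c *: X).
Proof.
move=> c0 [m [B ->]]; exists m, (sqrtC c *: B).
apply/matrixP => i j; rewrite !mxE mulr_sumr; apply: eq_bigr => k _.
rewrite !mxE rmorphM /= [(sqrtC c)^*]conj_Creal ?ger0_real ?sqrtC_ge0 //.
by rewrite mulrACA -expr2 sqrtCK.
Qed.

Lemma is_gram_congr (C : numClosedFieldType) (m n : nat) (X : 'M[C]_m)
    (A : 'M[C]_(m, n)) : is_gram X -> is_gram (A^t* *m X *m A).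
Proof.
by move=> [p [B ->]]; exists p, (B *m A); rewrite adjmx_mul !mulmxA.
Qed.

Lemma is_gram_tens (C : numClosedFieldType) (m n : nat) (X : 'M[C]_m)
    (Y : 'M[C]_n) : is_gram X -> is_gram Y -> is_gram (X *t Y).
Proof.
move=> [p [A ->]] [q [B ->]]; exists (p * q)%N, (A *t B).
by rewrite trmx_tens map_mxT tensmx_mul.
Qed.

Lemma is_gram_ptraceB (C : numClosedFieldType) (D : nat)
    (Z : 'M[C]_(D * D)) : is_gram Z -> is_gram (ptraceB Z).
Proof.
move=> [m [G ->]].
(* The traced-out index of register B moves from the columns of [G] to the rows, stacking [D] blocks
   of size m by D. *)
exists (m * D)%N, (\matrix_(r, j) G (mxtens_unindex r).1
                      (mxtens_index (j, (mxtens_unindex r).2))).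
apply/matrixP => i j; rewrite !mxE; under eq_bigr do rewrite mxE.
rewrite exchange_big pair_bigA /=.
rewrite (reindex (@mxtens_unindex m D)) /=; last first.
  by exists (@mxtens_index m D) => k _;
    rewrite (mxtens_indexK, mxtens_unindexK).
by apply: eq_bigr => k _; rewrite !mxE.
Qed.

(** Diagonalise X = P^* diag(d) P with P unitary and d nonnegative; the square root of diag(d) times
    P is a Gram factor. *)
Lemma densitymx_is_gram (C : numClosedFieldType) (D : nat) (X : 'M[C]_D) :
  densitymx X -> is_gram X.
Proof.
move=> [Xherm Xge0 _].
have /orthomx_spectralP XE := hermitian_normalmx Xherm.
have PU := spectral_unitarymx X; move: XE PU.
set P := spectralmx X; set d := spectral_diag X => XE PU.
rewrite invmx_unitary // in XE.
have PP : P *m P^t* = 1%:M by apply/unitarymxP.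
have dE : diag_mx d = P *m X *m P^t*.
  by rewrite XE !mulmxA PP mul1mx -mulmxA PP mulmx1.
have d0 i : 0 <= d 0 i.
  (* On the eigenvector P^* e_i the quadratic form of [X] takes the value d_i. *)
  have := Xge0 (P^t* *m delta_mx i 0).
  rewrite adjmx_mul adjmxK -!mulmxA [X *m _]mulmxA [P *m (_ *m _)]mulmxA.
  rewrite [P *m (X *m _)]mulmxA -dE mul_diag_mx mxE (bigD1 i) //= big1.
    by rewrite !mxE !eqxx /= conjC1 mul1r mulr1 addr0.
  by move=> j /negbTE ji; rewrite !mxE ji /= conjC0 mul0r.
rewrite XE; apply: is_gram_congr.
exists D, (diag_mx (map_mx sqrtC d)); apply/matrixP => i j.
rewrite mul_mx_diag !mxE; case: (eqVneq j i) => [->|_].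
  rewrite !mulr1n [(sqrtC _)^*]conj_Creal ?ger0_real ?sqrtC_ge0 //.
  by rewrite -expr2 sqrtCK.
by rewrite !mulr0n conjC0 mul0r.
Qed.

(** * The SWAP gadget on Gram matrices of trace one *)

Lemma swap_proj_herm (C : numClosedFieldType) (D : nat) (b : bool) :
  (swap_proj C D b)^t* = swap_proj C D b.
Proof.
apply/matrixP => i j; rewrite !mxE rmorphM rmorphD rmorphM /=.
rewrite fmorphV rmorph_nat !rmorph_nat rmorph_sign [j == i]eq_sym.
congr (_ * (_ + _ * _%:R)).
by rewrite andbC eq_sym [(mxtens_unindex j).1 == _]eq_sym.
Qed.

Definition gram_state (C : numClosedFieldType) (D : nat) (X : 'M[C]_D) : Prop :=
  is_gram X /\ \tr X = 1.

Section SwapGadget.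
Variables (C : numClosedFieldType) (D : nat) (b : bool) (X Y : 'M[C]_D).
Hypotheses (hX : gram_state X) (hY : gram_state Y).

Let Z := swap_proj C D b *m (X *t Y) *m swap_proj C D b.

Let gramZ : is_gram Z.
Proof.
(* Reading the left projector as its own adjoint makes [Z] a congruence of the tensor product. *)
rewrite /Z -{1}swap_proj_herm; apply: is_gram_congr.
by apply: is_gram_tens; [case: hX | case: hY].
Qed.

Let trZ : \tr Z = swap_prob b X Y.
Proof. by apply: swap_prob_born; [case: hX | case: hY]. Qed.

Lemma swap_prob_ge0 : 0 <= swap_prob b X Y.
Proof. by rewrite -trZ; apply: is_gram_tr_ge0. Qed.

(** Holds at probability zero too: there [Z] is a Gram matrix of trace zero, hence zero, and both
    sides vanish. *)
Lemma swap_prob_state : swap_prob b X Y *: swap_state b X Y =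
  4^-1 *: (X + Y + outcome_sign C b *: (X *m Y + Y *m X)).
Proof.
have -> : 4^-1 *: (X + Y + outcome_sign C b *: (X *m Y + Y *m X)) = ptraceB Z.
  by rewrite ptraceB_swap (proj2 hX) (proj2 hY) !scale1r.
rewrite /swap_state -/Z scalerA; case: (eqVneq (swap_prob b X Y) 0) => p0.
  have -> : Z = 0 by apply: is_gram_tr0; rewrite // trZ.
  rewrite p0 mul0r scale0r; apply/matrixP => i j.
  by rewrite !mxE big1 // => k _; rewrite mxE.
by rewrite mulfV // scale1r.
Qed.

Lemma swap_state_gram : swap_prob b X Y != 0 -> gram_state (swap_state b X Y).
Proof.
move=> p0; split.
  by apply: is_gramZ; [rewrite invr_ge0 swap_prob_ge0 | exact: is_gram_ptraceB].
(* After multiplying by the probability p, the trace to compute is (2 + 2 sigma Tr[XY]) / 4 = p. *)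
apply: (mulfI p0); rewrite -mxtraceZ swap_prob_state.
rewrite mxtraceZ !mxtraceD mxtraceZ mxtraceD (proj2 hX) (proj2 hY).
rewrite [\tr (Y *m X)]mxtrace_mulC -!mulr2n mulrnAr -mulrnDl mulr1.
rewrite /swap_prob -[_ *+ 2]mulr_natl mulrA.
by rewrite (natrM _ 2 2) invfM mulfVK ?pnatr_eq0.
Qed.

End SwapGadget.

(** * Splitting sums and parities over outcome triples *)

Lemma sum_prod_bool (V : nmodType) (S T : finType) (F : S * T * bool -> V) :
  \sum_s F s = \sum_a \sum_b (F (a, b, false) + F (a, b, true)).
Proof.
rewrite pair_bigA /=.
transitivity (\sum_(p : S * T) \sum_(o : bool) F (p, o)).
  by rewrite pair_bigA; apply: eq_bigr => -[].
by apply: eq_bigr => -[a b] _; rewrite big_bool addrC.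
Qed.

Lemma scale_quarter_double (C : numClosedFieldType) (V : lmodType C) (x : V) :
  4^-1 *: (x + x) = 2^-1 *: x.
Proof.
by rewrite -mulr2n -scaler_nat scalerA (natrM _ 2 2) invfM mulfVK ?pnatr_eq0.
Qed.

Lemma scale_half_double (C : numClosedFieldType) (V : lmodType C) (x : V) :
  2^-1 *: (x + x) = x.
Proof.
by rewrite -mulr2n -scaler_nat scalerA mulVf ?pnatr_eq0 ?scale1r.
Qed.

Lemma parityS (C : numClosedFieldType) (l : nat) (a b : outcomes l)
    (o : bool) :
  parity C ((a, b, o) : outcomes l.+1) =
  parity C a * parity C b * outcome_sign C o.
Proof. by rewrite /parity /= !big_cat big_seq1 /= mulrA. Qed.

(** * Unnormalised branch operators and their averages over the tree *)

Section Branches.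
Variables (C : numClosedFieldType) (D : nat) (rho : 'M[C]_D).
Hypothesis hrho : densitymx rho.

(** Both claims go through one induction, since the gadget needs states as inputs; a null subtree
    makes the whole branch null. *)
Lemma branch_gram (l : nat) (s : outcomes l) :
  0 <= branch_prob rho s /\
  (branch_prob rho s != 0 -> gram_state (branch_state rho s)).
Proof.
elim: l s => [|l IHl] /= => [_|[[a b] o]].
  split=> [|_]; first exact: ler01.
  by split; [exact: densitymx_is_gram | case: hrho].
have [[Pa ga] [Pb gb]] := (IHl a, IHl b).
case: (eqVneq (branch_prob rho a) 0) => [->|/ga {}ga].
  by rewrite !mul0r eqxx.
case: (eqVneq (branch_prob rho b) 0) => [->|/gb {}gb].
  by rewrite mulr0 !mul0r eqxx.
split; first exact: mulr_ge0 (mulr_ge0 Pa Pb) (swap_prob_ge0 o ga gb).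
by rewrite mulf_eq0 negb_or => /andP[_]; apply: swap_state_gram.
Qed.

Definition branch_op (l : nat) (s : outcomes l) : 'M[C]_D :=
  branch_prob rho s *: branch_state rho s.

Lemma branch_opS (l : nat) (a b : outcomes l) (o : bool) :
  branch_op ((a, b, o) : outcomes l.+1) =
  4^-1 *: (branch_prob rho b *: branch_op a + branch_prob rho a *: branch_op b +
           outcome_sign C o *: (branch_op a *m branch_op b +
                                branch_op b *m branch_op a)).
Proof.
rewrite /branch_op /=.
have [[_ ga] [_ gb]] := (branch_gram a, branch_gram b).
(* If a subtree is null, so is its branch operator, and every term on the right carries one of the
   two as a factor. *)
case: (eqVneq (branch_prob rho a) 0) => [->|/ga {}ga].
  by rewrite !(mul0r, scale0r, scaler0, mul0mx, mulmx0, addr0).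
case: (eqVneq (branch_prob rho b) 0) => [->|/gb {}gb].
  by rewrite !(mul0r, mulr0, scale0r, scaler0, mul0mx, mulmx0, addr0).
rewrite -scalerA swap_prob_state // [LHS]scalerA [_ * 4^-1]mulrC -scalerA.
congr (_ *: _).
rewrite -!scalemxAl -!scalemxAr !scalerDr !scalerA.
congr (_ *: _ + _ + (_ *: _ + _ *: _)); first exact: mulrC.
  by rewrite mulrC mulrA.
by rewrite mulrC [_ * branch_prob rho b]mulrC mulrA.
Qed.

(** Null branches have zero branch operator, so the sum extends to all strings and can be split
    along the recursion. *)
Lemma sum_branch_positive (l : nat) (c : outcomes l -> C) :
  \sum_(s : outcomes l | 0 < branch_prob rho s)
    (branch_prob rho s * c s) *: branch_state rho s =
  \sum_s c s *: branch_op s.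
Proof.
rewrite big_mkcond; apply: eq_bigr => s _; rewrite scalerA [c s * _]mulrC.
have [P0 _] := branch_gram s; rewrite lt0r P0 andbT.
by case: eqVneq => // ->; rewrite mul0r scale0r.
Qed.

Lemma sum_outcomesS (V : nmodType) (l : nat) (F : outcomes l.+1 -> V) :
  \sum_s F s = \sum_a \sum_b (F (a, b, false) + F (a, b, true)).
Proof. exact: sum_prod_bool. Qed.

Lemma sum_branch_prob (l : nat) : \sum_(s : outcomes l) branch_prob rho s = 1.
Proof.
elim: l => [|l IHl]; first by rewrite (big_pred1 tt) // => -[].
rewrite sum_outcomesS /= -[RHS](mulr1 1) -{1}IHl -IHl big_distrlr.
apply: eq_bigr => a _; apply: eq_bigr => b _ /=.
rewrite -mulrDr /swap_prob /outcome_sign expr0 expr1 mul1r mulN1r -mulrDr.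
by rewrite addrACA subrr addr0 mulVf ?pnatr_eq0 ?mulr1.
Qed.

Lemma sum_branch_op (l : nat) : \sum_(s : outcomes l) branch_op s = rho.
Proof.
elim: l => [|l IHl].
  by rewrite (big_pred1 tt) => [|[]]; rewrite // /branch_op /= scale1r.
rewrite sum_outcomesS.
under eq_bigr => a _.
  under eq_bigr => b _.
    rewrite !branch_opS /outcome_sign expr0 expr1 scale1r scaleN1r.
    (* The anticommutators cancel between the two outcomes. The remaining terms factor over the
       subtrees, and the probabilities of each subtree sum to 1. *)
    rewrite -scalerDr addrACA subrr addr0 scale_quarter_double scalerDr.
  over.
  rewrite big_split /= -!scaler_sumr -scaler_suml sum_branch_prob scale1r IHl.
over.
by rewrite big_split /= -!scaler_sumr -scaler_suml sum_branch_prob scale1r IHl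
  -scalerDr scale_half_double.
Qed.

Lemma sum_parity_branch_op (l : nat) :
  \sum_(s : outcomes l) parity C s *: branch_op s = rho ^+ (2 ^ l).
Proof.
elim: l => [|l IHl].
  rewrite (big_pred1 tt) => [|[]] //.
  by rewrite /branch_op /parity big_nil !scale1r expr1.
rewrite sum_outcomesS expnSr exprM expr2 -IHl.
set T := \sum_s parity C s *: branch_op s.
(* The square is split into two halves, expanded in opposite orders of [a] and [b], so as to match
   the anticommutator termwise. *)
rewrite -[RHS]scale_half_double -[T * T]/(T *m T).
have TE : T *m T =
    \sum_(a : outcomes l) \sum_(b : outcomes l)
      (parity C a * parity C b) *: (branch_op a *m branch_op b).
  rewrite /T mulmx_suml; apply: eq_bigr => a _; rewrite mulmx_sumr.
  by apply: eq_bigr => b _; rewrite -scalemxAl -scalemxAr scalerA.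
have TE' : T *m T =
    \sum_(a : outcomes l) \sum_(b : outcomes l)
      (parity C a * parity C b) *: (branch_op b *m branch_op a).
  rewrite TE exchange_big; apply: eq_bigr => a _; apply: eq_bigr => b _.
  by rewrite [parity C b * _]mulrC.
rewrite [X in _ *: (X + _)]TE [X in _ *: (_ + X)]TE'.
rewrite -big_split scaler_sumr; apply: eq_bigr => a _ /=.
rewrite -big_split scaler_sumr; apply: eq_bigr => b _ /=.
rewrite !parityS !branch_opS /outcome_sign expr0 expr1 scale1r scaleN1r mulr1.
(* The sign of the last outcome turns the sum into a difference: the terms linear in the branch
   operators cancel and the anticommutator doubles. *)
rewrite mulrN1 scaleNr -scalerBr -scalerBr opprD opprK addrACA subrr add0r.
by rewrite scale_quarter_double -scalerDr [LHS]scalerA [RHS]scalerA [in RHS]mulrC.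
Qed.

End Branches.

Theorem theorem1 (R : realType) (M : nat) (hM : (1 <= M)%N)
    (rho : 'M[R[i]]_(2 ^ M)) (hrho : densitymx rho)
    (l : nat) (hl : (1 <= l)%N) :
  \sum_(s : outcomes l | 0 < branch_prob rho s)
     branch_prob rho s *: branch_state rho s = rho
  /\
  \sum_(s : outcomes l | 0 < branch_prob rho s)
     (branch_prob rho s * parity R[i] s) *: branch_state rho s
    = rho ^+ (2 ^ l).
Proof.
split; last by rewrite sum_branch_positive // sum_parity_branch_op.
(* The plain average is the weighted one with constant weight 1. *)
under eq_bigr do rewrite -[branch_prob rho _]mulr1.
rewrite (sum_branch_positive hrho (fun=> 1)).
by under eq_bigr do rewrite scale1r; apply: sum_branch_op.
Qed.
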